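(* If $G$ is a connected bipartite graph, then $\chi'_c(G)=\chi'(G)$.
   Context: All graphs are finite and simple. The chromatic index $\chi'(G)$ is the minimum number of colours in a proper edge colouring of $G$. An ordering $e_1,\dots,e_m$ of the edges of $G$ is connected if for every $i\ge 2$ the edge $e_i$ shares an endpoint with some $e_j$, $j<i$. The greedy edge colouring following an ordering $e_1,\dots,e_m$ assigns, for $i=1,\dots,m$, to $e_i$ the smallest positive integer not already assigned to an edge $e_j$ ($j<i$) sharing an endpoint with $e_i$. The connected greedy chromatic index $\chi'_c(G)$ (defined for connected $G$) is the minimum, over all connected orderings of $E(G)$, of the number of colours used by the greedy edge colouring following that ordering. *)

(* Defs.v *)
From HB Require Import structures.
From mathcomp Require Import all_boot.

Set Implicit Arguments.
Unset Strict Implicit.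
Unset Printing Implicit Defensive.

Record sgraph := SGraph {
  vertex :> finType;
  adj : rel vertex;
  adj_sym : symmetric adj;
  adj_irr : irreflexive adj }.

Definition connected_graph (G : sgraph) : Prop :=
  forall x y : G, connect (@adj G) x y.

Definition bipartite (G : sgraph) : Prop :=
  exists A : {set G}, forall x y : G, adj x y -> (x \in A) != (y \in A).

Definition edges (G : sgraph) : {set {set G}} :=
  [set [set x; y] | x in G, y in G & adj x y].

Definition edge (G : sgraph) : finType := {a : {set G} | a \in edges G}.

(* Every edge shares an endpoint with itself, so distinctness has to be
   required separately where it matters. *)
Definition share_endpoint (G : sgraph) (a b : edge G) : bool :=
  [exists x : G, (x \in val a) && (x \in val b)].

Definition proper_edge_coloring (G : sgraph) (C : eqType) (c : edge G -> C) :
    bool :=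
  [forall a, forall b, (a != b) && share_endpoint a b ==> (c a != c b)].

Definition edge_colorable (G : sgraph) (k : nat) : bool :=
  [exists c : {ffun edge G -> 'I_k}, proper_edge_coloring c].

Lemma ex_edge_colorable (G : sgraph) : exists k, edge_colorable G k.
Proof.
exists #|edge G|; apply/existsP; exists [ffun a => enum_rank a].
apply/forallP=> a; apply/forallP=> b; apply/implyP=> /andP[ab _].
by rewrite !ffunE (inj_eq enum_rank_inj).
Qed.

Definition chromatic_index (G : sgraph) : nat := ex_minn (ex_edge_colorable G).

Lemma ex_fresh_color (s : seq nat) : exists n, (0 < n) && (n \notin s).
Proof.
have le_sum x : x \in s -> x <= sumn s.
  elim: s => //= y s IHs; rewrite inE => /orP[/eqP->|/IHs le_x].
    exact: leq_addr.
  exact: leq_trans le_x (leq_addl _ _).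
exists (sumn s).+1; rewrite ltn0Sn /=.
by apply/negP=> /le_sum; rewrite ltnn.
Qed.

Definition fresh_color (s : seq nat) : nat := ex_minn (ex_fresh_color s).

Definition greedy_step (G : sgraph) (c : seq (edge G * nat)) (a : edge G) :
    seq (edge G * nat) :=
  rcons c (a, fresh_color [seq p.2 | p <- c & share_endpoint a p.1]).

(* The list of pairs (e_i, colour of e_i), in the order of s. *)
Definition greedy_coloring (G : sgraph) (s : seq (edge G)) :
    seq (edge G * nat) :=
  foldl (@greedy_step G) [::] s.

Definition greedy_num_colors (G : sgraph) (s : seq (edge G)) : nat :=
  size (undup [seq p.2 | p <- greedy_coloring s]).

Definition edge_ordering (G : sgraph) (s : seq (edge G)) : bool :=
  perm_eq s (enum (edge G)).

Definition connected_seq (G : sgraph) (n : nat) (s : n.-tuple (edge G)) :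
    bool :=
  [forall i : 'I_n, (0 < i) ==>
    [exists j : 'I_n, (j < i) && share_endpoint (tnth s i) (tnth s j)]].

Definition connected_greedy_colorable (G : sgraph) (k : nat) : bool :=
  [exists s : #|edge G|.-tuple (edge G),
    [&& edge_ordering s, connected_seq s & greedy_num_colors s == k]].

Lemma edge_vertex (G : sgraph) (a : edge G) : exists x, x \in val a.
Proof.
by case: a => a /= /imset2P[x y _ _ ->]; exists x; rewrite !inE eqxx.
Qed.

Lemma ex_next_edge (G : sgraph) (connG : connected_graph G)
    (s : seq (edge G)) (b c : edge G) :
  b \notin s -> c \in s ->
  exists a d, [/\ a \notin s, d \in s & share_endpoint a d].
Proof.
move=> bs cs; have [x xc] := edge_vertex c; have [y yb] := edge_vertex b.
pose S := [pred v : G | has (fun d : edge G => v \in val d) s].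
have xS : x \in S by apply/hasP; exists c.
have [/hasP[d ds yd]|yS] := boolP (y \in S).
  by exists b, d; split=> //; apply/existsP; exists y; rewrite yb yd.
have [/existsP[u /existsP[v /and3P[uS vS uv]]]|noexit] :=
  boolP [exists u, exists v, [&& u \in S, v \notin S & adj u v]].
  have uvE : [set u; v] \in edges G.
    by apply/imset2P; exists u v; rewrite ?inE.
  have /hasP[d ds ud] := uS.
  pose a : edge G := Sub [set u; v] uvE.
  exists a, d; split=> //.
    apply: contra vS => a_s; apply/hasP; exists a => //.
    by rewrite /= !inE eqxx orbT.
  by apply/existsP; exists u; rewrite /= !inE eqxx ud.
suff /closed_connect/(_ _ _ (connG x y)) : closed (@adj G) S.
  by rewrite xS (negPf yS).
apply: intro_closed; first exact/sym_connect_sym/adj_sym.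
move=> u v uv uS; apply: contraNT noexit => vS.
by apply/existsP; exists u; apply/existsP; exists v; apply/and3P.
Qed.

Lemma ex_connected_seq (G : sgraph) (connG : connected_graph G) (n : nat) :
  n <= #|edge G| ->
  exists s : n.-tuple (edge G), uniq s && connected_seq s.
Proof.
elim: n => [_|n IHn ltn].
  by exists [tuple]; apply/forallP=> -[].
have [s /andP[us cs]] := IHn (ltnW ltn).
have [b bs] : exists b, b \notin s.
  apply/existsP; apply: contraTT ltn => /existsPn sall; rewrite -leqNgt.
  rewrite -(size_tuple s) -(card_uniqP us); apply/subset_leq_card/subsetP => a _.
  by have := sall a; rewrite negbK.
have [a [as_ ad]] : exists a, a \notin s /\
    (0 < n -> exists2 d, d \in s & share_endpoint a d).
  case: (posnP n) => [n0|n_gt0]; first by exists b; split; rewrite // n0.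
  have [a [d [as_ ds ad]]] := ex_next_edge connG bs (mem_tnth (Ordinal n_gt0) s).
  by exists a; split=> // _; exists d.
exists [tuple of rcons s a]; rewrite rcons_uniq as_ us /=.
apply/forallP=> i; apply/implyP=> i_gt0; rewrite (tnth_nth a) /= nth_rcons size_tuple.
have [lt_in|le_ni] := ltnP i n.
  have /existsP[j /andP[ltj sh]] := implyP (forallP cs (Ordinal lt_in)) i_gt0.
  apply/existsP; exists (widen_ord (leqnSn n) j); rewrite (tnth_nth a) /=.
  rewrite nth_rcons size_tuple ltn_ord ltj /=.
  by move: sh; rewrite !(tnth_nth a).
have iE : i = n :> nat by apply/eqP; rewrite eqn_leq le_ni andbT -ltnS.
rewrite iE eqxx; rewrite iE in i_gt0.
have [d /tnthP[j ->] sh] := ad i_gt0.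
apply/existsP; exists (widen_ord (leqnSn n) j); rewrite (tnth_nth a) /=.
by rewrite nth_rcons size_tuple ltn_ord -tnth_nth sh.
Qed.

Lemma ex_connected_greedy_colorable (G : sgraph) (connG : connected_graph G) :
  exists k, connected_greedy_colorable G k.
Proof.
have [s /andP[us cs]] := ex_connected_seq connG (leqnn _).
exists (greedy_num_colors s); apply/existsP; exists s; rewrite cs eqxx !andbT.
apply: uniq_perm => //; first exact: enum_uniq.
have sub : {subset s <= enum (edge G)} by move=> a _; rewrite mem_enum.
by apply: (uniq_min_size us sub _).2; rewrite !size_tuple.
Qed.

Definition connected_greedy_chromatic_index (G : sgraph)
    (connG : connected_graph G) : nat :=
  ex_minn (ex_connected_greedy_colorable connG).

(* Main.v *)
Require Import Defs.
From mathcomp Require Import all_boot.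

(** Let D be the maximum degree.  By induction on D, for every root r there is
    a D-edge-colouring that a greedy colouring can follow along a connected
    ordering, starting at r, of the edges of the component of r.  Peel off a
    matching M that covers all vertices of degree D: the remaining components
    are coloured with D - 1 colours by induction, each from a root of our
    choice, and the edges of M receive the last colour.  Once a component is
    coloured, an edge of M leaving it at a vertex of degree D does receive the
    last colour, and gives access to the next component, which is then coloured
    from its entry vertex.  The point is to choose M such that every component
    can be entered in this way.  Take M for which the set R of vertices reached
    is largest.  If R is not everything, an edge of M leaves R at a vertex of
    smaller degree and ends at a vertex z of degree D.  By Konig's theorem the
    subgraph outside R has a matching that covers z and all its vertices of
    degree D; exchanging M for it outside R makes R larger. *)

Set Implicit Arguments.
Unset Strict Implicit.
Unset Printing Implicit Defensive.

Lemma ex_notin_seq (T : finType) (s : seq T) :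
  size s < #|T| -> exists x, x \notin s.
Proof.
move=> lts; apply/existsP; apply: contraTT lts => /existsPn all_s.
rewrite -leqNgt cardE; apply: uniq_leq_size (enum_uniq _) _ => x _.
by rewrite -[_ \in _]negbK.
Qed.

Lemma perm_eq_enum (T : finType) (s : seq T) :
  uniq s -> size s = #|T| -> perm_eq s (enum T).
Proof.
move=> us sT; apply: uniq_perm (enum_uniq _) _ => //.
have sub : {subset s <= enum T} by move=> x _; rewrite mem_enum.
by apply: (uniq_min_size us sub _).2; rewrite sT cardE.
Qed.

Definition swap (T : eqType) (a b : T) : T -> T :=
  [eta id with a |-> b, b |-> a].

Lemma swapK (T : eqType) (a b : T) : involutive (swap a b).
Proof.
move=> k; rewrite /swap /=; have [->|/negPf ka] := eqVneq k a.
  by rewrite eqxx; case: eqVneq.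
by have [->|/negPf kb] := eqVneq k b; rewrite ?eqxx ?ka ?kb.
Qed.

Lemma swap_lt (a b n k : nat) : a < n -> b < n -> k < n -> swap a b k < n.
Proof. by move=> *; rewrite /swap /=; case: ifP => // _; case: ifP. Qed.

Lemma connect_min (V : finType) (e : rel V) (r : V) (S : {pred V}) :
    r \in S -> (forall x y, x \in S -> e x y -> y \in S) ->
  {subset connect e r <= S}.
Proof.
move=> rS eS _ /connectP[p + ->].
by elim: p r rS => //= y p IHp x xS /andP[/(eS _ _ xS)yS]; apply: IHp.
Qed.

Lemma connect_rank (V : finType) (e : rel V) (r : V) :
  exists d : V -> nat, forall x, connect e r x ->
    x = r \/ exists y, [/\ connect e r y, e y x & d y < d x].
Proof.
pose walk x n := [exists p : n.-tuple V, path e r p && (last r p == x)].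
have walkI p : path e r p -> walk (last r p) (size p).
  by move=> ep; apply/existsP; exists (in_tuple p); rewrite ep /=.
have ex_walk x : exists n, connect e r x ==> walk x n.
  have [/connectP[p ep ->]|] := boolP (connect e r x); last by exists 0.
  by exists (size p); apply: walkI.
exists (fun x => ex_minn (ex_walk x)) => x rx.
case: (ex_minnP (ex_walk x)) => n; rewrite rx /=.
case/existsP=> -[p /= /eqP <-] /andP[].
case/lastP: p => [_ /eqP|p z]; first by left.
rewrite rcons_path last_rcons size_rcons => /andP[ep epz] /eqP zx min_n.
right; exists (last r p); rewrite -zx epz.
have rp : connect e r (last r p) by apply/connectP; exists p.
by split=> //; case: ex_minnP => m _; apply; rewrite rp; apply: walkI.
Qed.

Lemma connect_last (V : finType) (e : rel V) (x z : V) :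
  connect e x z -> z = x \/ exists2 y, connect e x y & e y z.
Proof.
have [d dP] := connect_rank e x; case/dP=> [|[y [xy yz _]]]; first by left.
by right; exists y.
Qed.

(* [entry] picks in every component of [link] the vertex through which [step],
   starting from r, first enters it. *)
Definition component_entries (V : finType) (link step : rel V) (r : V)
    (entry : V -> V) (rank : V -> nat) :=
  [/\ forall x, connect link x (entry x),
      forall x y, connect link x y -> entry x = entry y
    & forall x, connect step r x -> entry x = r \/ exists y,
        [/\ connect step r y, step y (entry x)
          & rank (entry y) < rank (entry x)]].

Lemma ex_component_entries (V : finType) (link step : rel V) (r : V) :
    connect_sym link -> subrel link step ->
  exists entry rank, component_entries link step r entry rank.
Proof.
move=> link_sym sub; have [d dP] := connect_rank step r.
pose entry x :=
  [arg min_(y < root link x | connect link (root link x) y) d y].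
have entryP x :
    connect link x (entry x) /\
    forall y, connect link x y -> d (entry x) <= d y.
  rewrite /entry; case: arg_minnP => [|y ry ymin]; first exact: connect0.
  have xr := connect_root link x; split; first exact: connect_trans xr ry.
  by move=> z xz; apply: ymin; apply: connect_trans xz; rewrite link_sym.
exists entry, d; split=> [x|x y|x rx]; first by case: (entryP x).
  by rewrite /entry => /(rootP link_sym) ->.
have [xe _] := entryP x; have /dP[|[y [ry ye lty]]] : connect step r (entry x).
- apply: connect_trans rx _; apply: connect_sub xe => y z yz.
  exact/connect1/sub.
- by left.
right; exists y; split=> //; apply: leq_ltn_trans lty.
by case: (entryP y) => _; apply; apply: connect0.
Qed.

Section EdgeSets.

Variable G : sgraph.
Implicit Types (F H M N : {set edge G}) (S Z : {set G}) (e f : edge G).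
Implicit Types (x y z : G) (c : edge G -> nat) (D k : nat).

Definition meets S e := [exists x in val e, x \in S].

Definition edges_meeting F S := [set e in F | meets S e].

Definition endpoints F : {set G} := \bigcup_(e in F) val e.

Definition star F x := [set e in F | x \in val e].

Definition degree F x := #|star F x|.

Definition full F D := [set x | degree F x == D].

Definition linked F : rel G :=
  [rel x y | [exists e in F, (x \in val e) && (y \in val e)]].

Definition component F x := [set y | connect (linked F) x y].

Definition matching M := {in M &, forall e f, share_endpoint e f -> e = f}.

Definition proper_on F c :=
  {in F &, forall e f, share_endpoint e f -> c e = c f -> e = f}.

Definition edge_coloring F D c := {in F, forall e, c e < D} /\ proper_on F c.

Definition color_class F c k := [set e in F | c e == k].

Definition colors_at F c x := [seq c e | e in star F x].

Lemma edge_ends e : exists x y, adj x y /\ val e = [set x; y].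
Proof. by case: e => e /= /imset2P[x y _ /[!inE]/= xy ->]; exists x, y. Qed.

Lemma edge_endpoint_eq e x y z : x \in val e -> y \in val e -> z \in val e ->
  x != z -> y != z -> x = y.
Proof.
have [u [v [_ ->]]] := edge_ends e; rewrite !inE.
by do 3![case/orP => /eqP->]; rewrite ?eqxx.
Qed.

Lemma share_endpointP e f :
  reflect (exists2 x, x \in val e & x \in val f) (share_endpoint e f).
Proof. exact: exists_inP. Qed.

Lemma share_endpointI e f x :
  x \in val e -> x \in val f -> share_endpoint e f.
Proof. by move=> xe xf; apply/share_endpointP; exists x. Qed.

Lemma share_endpointC e f : share_endpoint e f = share_endpoint f e.
Proof. by apply/share_endpointP/share_endpointP => -[x]; exists x. Qed.

Lemma meetsP S e : reflect (exists2 x, x \in val e & x \in S) (meets S e).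
Proof. exact: exists_inP. Qed.

Lemma meetsI S e x : x \in val e -> x \in S -> meets S e.
Proof. by move=> xe xS; apply/meetsP; exists x. Qed.

Lemma meetsS S Z e : S \subset Z -> meets S e -> meets Z e.
Proof. by move=> /subsetP sSZ /meetsP[x xe /sSZ]; apply: meetsI. Qed.

Lemma not_meets S e x : ~~ meets S e -> x \in val e -> x \notin S.
Proof. by move=> + xe; apply/contraNN/meetsI. Qed.

Lemma endpointsP F x :
  reflect (exists2 e, e \in F & x \in val e) (x \in endpoints F).
Proof. exact: bigcupP. Qed.

Lemma mem_endpoints F e x : e \in F -> x \in val e -> x \in endpoints F.
Proof. by move=> eF xe; apply/endpointsP; exists e. Qed.

Lemma endpointsS F H : F \subset H -> endpoints F \subset endpoints H.
Proof.
move=> /subsetP sFH; apply/subsetP=> x /endpointsP[e /sFH].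
exact: mem_endpoints.
Qed.

Lemma starS F H x : F \subset H -> star F x \subset star H x.
Proof.
by move=> /subsetP sFH; apply/subsetP=> e /setIdP[/sFH eH xe]; rewrite inE eH.
Qed.

Lemma degreeS F H x : F \subset H -> degree F x <= degree H x.
Proof. by move=> /(starS x)/subset_leq_card. Qed.

Lemma degree_gt0 F x : (0 < degree F x) = (x \in endpoints F).
Proof.
apply/card_gt0P/endpointsP => [[e /setIdP[]]|[e eF xe]]; exists e => //.
by rewrite inE eF.
Qed.

Lemma degreeID F H x : degree F x = degree (F :&: H) x + degree (F :\: H) x.
Proof.
rewrite /degree -(cardsID H (star F x)); congr (_ + _); apply: eq_card => e.
  by rewrite !inE andbAC.
by rewrite !inE andbA.
Qed.

Lemma degree_setU1 F e x : e \notin F -> x \in val e ->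
  degree (e |: F) x = (degree F x).+1.
Proof.
move=> eF xe; rewrite /degree (cardsD1 e) !inE eqxx xe; congr _.+1.
apply: eq_card => f; rewrite !inE; have [->|//] := eqVneq f e.
by rewrite (negPf eF).
Qed.

Lemma linkedI F e x y : e \in F -> x \in val e -> y \in val e -> linked F x y.
Proof. by move=> eF xe ye; apply/exists_inP; exists e; rewrite // xe. Qed.

Lemma linked_connect_sym F : connect_sym (linked F).
Proof.
apply: sym_connect_sym => x y; apply: eq_existsb => e.
by rewrite [X in _ && X]andbC.
Qed.

Lemma component_edge F r e x y : e \in F -> x \in val e -> y \in val e ->
  x \in component F r -> y \in component F r.
Proof.
rewrite !inE => eF xe ye rx; exact/(connect_trans rx)/connect1/(linkedI eF).
Qed.

Lemma component_endpoint F r x :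
  x \in component F r -> x = r \/ x \in endpoints F.
Proof.
rewrite inE => /connect_last[->|[y _ /exists_inP[e eF /andP[_ xe]]]].
  by left.
by right; apply: mem_endpoints xe.
Qed.

Lemma linked_adj x y : adj x y -> linked setT x y.
Proof.
move=> xy; have xyE : [set x; y] \in edges G.
  by apply/imset2P; exists x y; rewrite ?inE.
by apply: (@linkedI _ (Sub [set x; y] xyE)); rewrite /= !inE ?eqxx ?orbT.
Qed.

Lemma colors_atP F c x k :
  reflect (exists e, [/\ e \in F, x \in val e & c e = k])
          (k \in colors_at F c x).
Proof.
apply: (iffP imageP) => [[e /setIdP[eF xe] ->]|[e [eF xe <-]]]; exists e => //.
by rewrite inE eF.
Qed.

Lemma mem_colors_at F c e x : e \in F -> x \in val e -> c e \in colors_at F c x.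
Proof. by move=> eF xe; apply/colors_atP; exists e. Qed.

Lemma colors_atS F H c x :
  star F x \subset H -> {subset colors_at F c x <= colors_at H c x}.
Proof.
move=> /subsetP sFH _ /colors_atP[e [eF xe <-]].
by apply: mem_colors_at; rewrite // sFH // inE eF.
Qed.

Lemma missing_color F c x D :
  degree F x < D -> exists2 k, k < D & k \notin colors_at F c x.
Proof.
move=> ltD; have /allPn[k] : ~~ all [in colors_at F c x] (iota 0 D).
  apply: contraL ltD => /allP/(uniq_leq_size (iota_uniq 0 D)).
  by rewrite size_iota size_image -leqNgt.
by rewrite mem_iota => ltk kx; exists k.
Qed.

Lemma uniq_colors_at F c x : proper_on F c -> uniq (colors_at F c x).
Proof.
move=> cP; apply/dinjectiveP => e f /setIdP[eF xe] /setIdP[fF xf].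
by apply: cP => //; apply: share_endpointI xf.
Qed.

Lemma colors_at_full F c x D k :
  edge_coloring F D c -> D <= degree F x -> k < D -> k \in colors_at F c x.
Proof.
move=> [cD cP] leD ltk; have us := uniq_colors_at x cP.
have sub : {subset colors_at F c x <= iota 0 D}.
  by move=> _ /colors_atP[e [eF _ <-]]; rewrite mem_iota cD.
have [|_ ->] := uniq_min_size us sub; last by rewrite mem_iota.
by rewrite size_iota size_image.
Qed.

Lemma matching_color_class F c k :
  proper_on F c -> matching (color_class F c k).
Proof.
by move=> cP e f /setIdP[eF /eqP<-] /setIdP[fF /eqP/esym cef] /cP; apply.
Qed.

Lemma full_sub_color_class F c D k :
    edge_coloring F D c -> k < D ->
  full F D \subset endpoints (color_class F c k).
Proof.
move=> cP ltk; apply/subsetP=> x /[!inE]/eqP xD.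
have /colors_atP[e [eF xe ck]] : k \in colors_at F c x.
  by apply: colors_at_full cP _ ltk; rewrite xD.
by apply: (mem_endpoints (e := e)); rewrite // inE eF ck eqxx.
Qed.

Lemma matchingS M N : M \subset N -> matching N -> matching M.
Proof. by move=> /subsetP sMN mN e f /sMN eN /sMN; apply: mN. Qed.

Lemma degree_matching M x : matching M -> x \in endpoints M -> degree M x = 1.
Proof.
move=> mM /endpointsP[e eM xe]; rewrite /degree.
rewrite (_ : star M x = [set e]) ?cards1 //.
apply/setP=> f; rewrite !inE; apply/andP/eqP => [[fM xf]|->//].
by apply: mM => //; apply: share_endpointI xe.
Qed.

Lemma degreeD_matching F M x : matching M -> M \subset F -> x \in endpoints M ->
  degree F x = (degree (F :\: M) x).+1.
Proof.
by move=> mM /setIidPr sMF xM; rewrite (degreeID F M) sMF (degree_matching mM).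
Qed.

Lemma edge_coloring_setU_matching F M D c k :
    matching M -> k < D -> edge_coloring F D c ->
    {in M & F, forall e f, share_endpoint e f -> c f != k} ->
  edge_coloring (M :|: F) D (fun f => if f \in M then k else c f).
Proof.
move=> mM ltk [cD cP] ck; split=> [e|e f] /setUP eMF.
  by case: ifPn => // eM; case: eMF eM => [->//|/cD].
move=> /setUP fMF ef; case: ifPn eMF => [eM _|eM [/idPn//|eF]];
  case: ifPn fMF => [fM _|fM [/idPn//|fF]].
- by move=> _; apply: mM.
- by move/esym/eqP; rewrite (negPf (ck e f eM fF ef)).
- by move/eqP; rewrite (negPf (ck f e fM eF _)) // share_endpointC.
- exact: cP.
Qed.

Lemma edge_coloring_add_matching F M D c :
    matching M -> M \subset F -> edge_coloring (F :\: M) D c ->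
  edge_coloring F D.+1 (fun e => if e \in M then D else c e).
Proof.
move=> mM /setIidPr sMF [cD cP]; rewrite -(setID F M) sMF.
apply: edge_coloring_setU_matching => // [|_ f _ /cD ltfD _].
  by split=> // e /cD/ltnW.
by rewrite neq_ltn ltfD.
Qed.

End EdgeSets.

Section KempeChanges.

Variable G : sgraph.
Implicit Types (F : {set edge G}) (Z : {set G}) (f g : edge G) (x : G).
Implicit Types (c : edge G -> nat) (a b D : nat).

Definition kempe_closed F c a b Z :=
  forall f, f \in F -> c f \in pred2 a b -> meets Z f -> val f \subset Z.

Definition kempe_swap c a b Z f := if meets Z f then swap a b (c f) else c f.

Lemma kempe_swapE F c a b Z f x :
    kempe_closed F c a b Z -> f \in F -> x \in val f ->
  kempe_swap c a b Z f = if x \in Z then swap a b (c f) else c f.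
Proof.
move=> Zcl fF xf; rewrite /kempe_swap; have [xZ|xZ] := boolP (x \in Z).
  by rewrite (meetsI xf).
case: ifP => // fZ; have : c f \notin pred2 a b.
  by apply: contraNN xZ => /(Zcl f fF)/(_ fZ)/subsetP; apply.
by rewrite !inE negb_or /swap /= => /andP[/negPf-> /negPf->].
Qed.

Lemma edge_coloring_kempe_swap F D c a b Z :
    a < D -> b < D -> kempe_closed F c a b Z -> edge_coloring F D c ->
  edge_coloring F D (kempe_swap c a b Z).
Proof.
move=> ltaD ltbD Zcl [cD cP]; split=> [f /cD|f g fF gF fg].
  by rewrite /kempe_swap; case: ifP => // _; apply: swap_lt.
have /share_endpointP[x xf xg] := fg.
rewrite !(kempe_swapE (x := x) Zcl) //; case: ifP => _; last exact: cP.
by move/(inv_inj (swapK a b)); apply: cP.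
Qed.

Lemma colors_at_kempe_swap F c a b Z x : kempe_closed F c a b Z ->
  colors_at F (kempe_swap c a b Z) x =
    if x \in Z then map (swap a b) (colors_at F c x) else colors_at F c x.
Proof.
move=> Zcl; have swE f : f \in enum (star F x) ->
    kempe_swap c a b Z f = if x \in Z then swap a b (c f) else c f.
  by rewrite mem_enum => /setIdP[]; apply: kempe_swapE.
by case: ifP swE => _ /eq_in_map; rewrite /colors_at /image_mem // -map_comp.
Qed.

End KempeChanges.

Definition hereditarily_class1 (G : sgraph) := forall (F : {set edge G}) D,
  (forall x, degree F x <= D) -> exists c, edge_coloring F D c.

Section Konig.

Variables (G : sgraph) (A : {set G}).
Hypothesis bipA : forall x y : G, adj x y -> (x \in A) != (y \in A).
Implicit Types (F : {set edge G}) (e f g : edge G) (x y z : G).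
Implicit Types (c : edge G -> nat) (D : nat).

Lemma bipartite_edge_ends e :
  exists x y, [/\ x \in A, y \notin A & val e = [set x; y]].
Proof.
have [x [y [/bipA xyA ->]]] := edge_ends e.
case: (boolP (x \in A)) xyA => xA.
  by rewrite eq_sym eqb_id; exists x, y.
by rewrite eq_sym eqbF_neg negbK; exists y, x; rewrite setUC.
Qed.

Lemma edge_side_inj e x y :
  x \in val e -> y \in val e -> (x \in A) = (y \in A) -> x = y.
Proof.
have [u [v [uA /negPf vA ->]]] := bipartite_edge_ends e.
by rewrite !inE => /orP[]/eqP-> /orP[]/eqP->; rewrite ?uA ?vA.
Qed.

(* The walk leaves A through colour b and the other side through colour a;
   since a is missing at its start, the vertices it reaches form a set closed
   under both colours. *)
Lemma ex_kempe_closed F c a b x :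
    proper_on F c -> x \in A -> a \notin colors_at F c x ->
  exists Z, [/\ kempe_closed F c a b Z, x \in Z
    & forall y, y \in Z -> y \notin A -> b \in colors_at F c y].
Proof.
move=> cP xA xa; pose out y := if y \in A then b else a.
pose step := [rel y z | ((y \in A) != (z \in A)) &&
  [exists f in F, [&& y \in val f, z \in val f & c f == out y]]].
have last_step z : connect step x z -> z != x ->
    exists2 y, connect step x y & exists f,
      [/\ (y \in A) != (z \in A), f \in F, y \in val f, z \in val f
        & c f = out y].
  move=> /connect_last[->|[y xy /= /andP[yz]]]; first by rewrite eqxx.
  case/exists_inP=> f fF /and3P[yf zf /eqP cf] _.
  by exists y => //; exists f.
exists [set y | connect step x y]; split; rewrite ?inE ?connect0 //; last first.
  move=> y /[!inE] xy yA; have [|z _ [f [zy fF _ yf cf]]] := last_step y xy.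
    by apply: contraNneq yA => ->.
  have zA : z \in A by move: zy; rewrite (negPf yA) eqbF_neg negbK.
  by apply/colors_atP; exists f; rewrite cf /out zA.
move=> f fF cf /meetsP[y yf /[!inE] xy]; apply/subsetP=> z zf; rewrite inE.
have [yz|yz] := eqVneq (y \in A) (z \in A).
  by rewrite -(edge_side_inj yf zf yz).
have [f_out|f_in] := eqVneq (c f) (out y).
  apply: connect_trans xy (connect1 _); rewrite /= yz.
  by apply/exists_inP; exists f; rewrite // yf zf f_out eqxx.
have {cf}f_in : c f = if y \in A then a else b.
  move: cf f_in; rewrite /out !inE.
  by case: (y \in A) => /orP[]/eqP->; rewrite ?eqxx.
have [|w xw [g [wy gF wg yg cg]]] := last_step y xy.
  apply: contraNneq xa => yx; rewrite -yx in xA *.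
  by apply/colors_atP; exists f; rewrite f_in xA.
have gf : g = f.
  apply: cP => //; first exact: share_endpointI yf.
  by rewrite cg f_in /out; case: (y \in A) (w \in A) wy => [] [].
rewrite (@edge_side_inj f z w) // -?gf //.
by move: yz wy; case: (y \in A) (z \in A) (w \in A) => [] [] [].
Qed.

Lemma ex_edge_coloring_setU1 F e D c :
    e \notin F -> (forall x, degree (e |: F) x <= D) -> edge_coloring F D c ->
  exists c', edge_coloring (e |: F) D c'.
Proof.
move=> eF degD cP; have [x [y [xA yA eE]]] := bipartite_edge_ends e.
have missing z : z \in val e -> exists2 k, k < D & k \notin colors_at F c z.
  by move=> ze; apply: missing_color; rewrite -(degree_setU1 eF ze).
have [|a ltaD ax] := missing x; first by rewrite eE !inE eqxx.
have [|b ltbD b_y] := missing y; first by rewrite eE !inE eqxx orbT.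
have [Z [Zcl xZ Zb]] := ex_kempe_closed b cP.2 xA ax.
have yZ : y \notin Z by apply: contraNN b_y => /Zb; apply.
have missing_b z : z \in val e -> b \notin colors_at F (kempe_swap c a b Z) z.
  rewrite eE !inE (colors_at_kempe_swap _ Zcl) => /orP[]/eqP->.
    have swap_a : swap a b a = b by rewrite /swap /= eqxx.
    by rewrite xZ -[X in X \notin _]swap_a (mem_map (inv_inj (swapK a b))).
  by rewrite (negPf yZ).
eexists; apply: (edge_coloring_setU_matching (M := [set e]) (k := b)) => //.
- by move=> f g /set1P-> /set1P->.
- exact: edge_coloring_kempe_swap ltaD ltbD Zcl cP.
move=> _ f /set1P-> fF /share_endpointP[z ze zf].
by apply: contraNneq (missing_b z ze) => fb; apply/colors_atP; exists f.
Qed.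

Theorem konig : hereditarily_class1 G.
Proof.
move=> F D; have [n] := ubnP #|F|; elim: n F => // n IHn F ltF degD.
have [->|[e eF]] := set_0Vmem F.
  by exists (fun=> 0); split=> [e|e f]; rewrite inE.
rewrite -(setD1K eF) in degD *.
have [||c cP] := IHn (F :\ e); first by move: ltF; rewrite (cardsD1 e) eF.
  by move=> x; apply: leq_trans (degD x); apply/degreeS/subsetUr.
by apply: ex_edge_coloring_setU1 cP; rewrite // !inE eqxx.
Qed.

End Konig.

Section Peelings.

Variable G : sgraph.
Implicit Types (F M N : {set edge G}) (R : {set G}) (e f g : edge G).
Implicit Types (r x y z : G) (D : nat).

Definition peeling F D M :=
  [/\ M \subset F, matching M, full F D \subset endpoints M
    & {in M, forall e, meets (full F D) e}].

(* A greedy colouring may pass freely through the edges outside M, but through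
   those of M, which carry the last colour, only from an endpoint of full
   degree. *)
Definition passable F D M : rel G :=
  [rel x y | [exists e in F,
    [&& x \in val e, y \in val e & (e \notin M) || (x \in full F D)]]].

Definition reach F D M r := [set x | connect (passable F D M) r x].

Definition passable_closed F D M R :=
  forall x y, x \in R -> passable F D M x y -> y \in R.

Definition outside F R := F :\: edges_meeting F R.

Definition exchange M N R :=
  N :|: (edges_meeting M R :\: edges_meeting M (endpoints N)).

Lemma passableI F D M e x y : e \in F -> x \in val e -> y \in val e ->
  (e \notin M) || (x \in full F D) -> passable F D M x y.
Proof. by move=> eF xe ye eM; apply/exists_inP; exists e; rewrite // xe ye. Qed.

Lemma reach_closed F D M r : passable_closed F D M (reach F D M r).
Proof. by move=> x y /[!inE] rx xy; apply: connect_trans rx (connect1 xy). Qed.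

Lemma mem_reach F D M r : r \in reach F D M r.
Proof. by rewrite inE. Qed.

Lemma reach_min F D M R r :
  r \in R -> passable_closed F D M R -> reach F D M r \subset R.
Proof.
move=> rR Rcl; apply/subsetP=> x /[!inE].
by apply: connect_min => // y z; apply: Rcl.
Qed.

Lemma component_min F R r :
    r \in R -> {in F, forall e, meets R e -> val e \subset R} ->
  component F r \subset R.
Proof.
move=> rR Rcl; apply/subsetP=> x /[!inE]; apply: connect_min => // y z yR.
case/exists_inP=> e eF /andP[ye ze].
by apply: (subsetP (Rcl e eF _)) ze; apply: meetsI yR.
Qed.

Lemma mem_outside F R e : (e \in outside F R) = (e \in F) && ~~ meets R e.
Proof. by rewrite !inE negb_and andbC; case: (e \in F). Qed.

Lemma peeling_meeting_full F D M :
    M \subset F -> matching M -> full F D \subset endpoints M ->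
  peeling F D (edges_meeting M (full F D)).
Proof.
move=> sMF mM covM; have sub : edges_meeting M (full F D) \subset M.
  by apply/subsetP=> e /setIdP[].
split; [exact: subset_trans sMF|exact: matchingS mM| |by move=> e /setIdP[]].
apply/subsetP=> x xD; have /endpointsP[e eM xe] := subsetP covM x xD.
by apply: mem_endpoints (xe); rewrite inE eM (meetsI xe).
Qed.

Lemma passable_closed_boundary F D M R e x y :
    passable_closed F D M R -> e \in F -> x \in val e -> y \in val e ->
    x \in R -> y \notin R ->
  e \in M /\ x \notin full F D.
Proof.
move=> Rcl eF xe ye xR yR; apply/andP; rewrite -[e \in M]negbK -negb_or.
by apply: contraNN yR => eM; apply: Rcl xR (passableI eF xe ye eM).
Qed.

Lemma peeling_boundary_full F D M R e x y :
    peeling F D M -> passable_closed F D M R -> e \in F -> x \in val e ->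
    y \in val e -> x \in R -> y \notin R ->
  y \in full F D.
Proof.
move=> [_ _ _ Mfull] Rcl eF xe ye xR yR.
have [eM xD] := passable_closed_boundary Rcl eF xe ye xR yR.
have /meetsP[z ze zD] := Mfull e eM.
rewrite (edge_endpoint_eq ye ze xe) //; first by apply: contraNneq yR => ->.
by apply: contraNneq xD => <-.
Qed.

Lemma matching_exchange M N R :
  matching M -> matching N -> matching (exchange M N R).
Proof.
move=> mM mN; have crossing e f : e \in N ->
      f \in edges_meeting M R :\: edges_meeting M (endpoints N) ->
    ~~ share_endpoint e f.
  move=> eN /setDP[/setIdP[fM _]]; rewrite inE fM /=; apply: contraNN.
  by case/share_endpointP=> x xe xf; apply: meetsI xf (mem_endpoints eN xe).
move=> e f /setUP[eN|eM] /setUP[fN|fM] ef.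
- exact: mN.
- by case/negP: (crossing e f eN fM).
- by case/negP: (crossing f e fN eM); rewrite share_endpointC.
- by case/setDP: eM fM => /setIdP[eM _] _ /setDP[/setIdP[fM _] _]; apply: mM.
Qed.

Lemma full_outside F D R x : x \in full F D ->
  {in star F x, forall e, ~~ meets R e} -> x \in full (outside F R) D.
Proof.
rewrite !inE => /eqP<- xR; apply/eqP/eq_card=> e; rewrite inE mem_outside.
rewrite [RHS]inE; apply/andP/andP=> [[/andP[]]//|[eF xe]].
by split=> //; rewrite eF xR // inE eF.
Qed.

Lemma full_sub_exchange F D M N R :
    peeling F D M -> passable_closed F D M R -> N \subset outside F R ->
    full (outside F R) D \subset endpoints N ->
  full F D \subset endpoints (exchange M N R).
Proof.
move=> [sMF _ covM _] Rcl /subsetP sN covN; apply/subsetP=> x xD.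
have [xN|xN] := boolP (x \in endpoints N).
  exact: subsetP (endpointsS (subsetUl _ _)) x xN.
have [g [gM xg gR]] : exists g, [/\ g \in M, x \in val g & meets R g].
  have [xR|xR] := boolP (x \in R).
    have /endpointsP[g gM xg] := subsetP covM x xD.
    by exists g; rewrite (meetsI xg).
  have /exists_inP[g /setIdP[gF xg] gR] : [exists g in star F x, meets R g].
    apply: contraNT xN => /exists_inPn none; apply: (subsetP covN).
    exact: full_outside.
  exists g; have /meetsP[w wg wR] := gR.
  by have [] := passable_closed_boundary Rcl gF wg xg wR xR.
apply: mem_endpoints (xg); rewrite !inE gM gR /= andbT; apply/orP; right.
apply/negP=> /meetsP[y yg yN]; have /endpointsP[h /sN] := yN.
rewrite mem_outside => /andP[_ hR] yh; have yR := not_meets hR yh.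
have xR : x \notin R.
  apply: contraL xD => xR.
  by have [] := passable_closed_boundary Rcl (subsetP sMF g gM) xg yg xR yR.
have /meetsP[w wg wR] := gR; case/negP: xN.
rewrite (edge_endpoint_eq xg yg wg) //; first by apply: contraNneq xR => ->.
by apply: contraNneq yR => ->.
Qed.

(* Exchanging M for N outside the set reached keeps the passages inside that
   set and opens a passage out of it through e. *)
Lemma proper_reach_exchange F D M N r e x y (R := reach F D M r) :
    N \subset outside F R -> e \in F -> x \in val e -> x \in R ->
    y \in val e -> y \in endpoints N ->
  R \proper reach F D (edges_meeting (exchange M N R) (full F D)) r.
Proof.
move=> sN eF xe xR ye yN; set M1 := edges_meeting _ _.
have N_R f z : f \in N -> z \in val f -> z \notin R.
  by move/(subsetP sN); rewrite mem_outside => /andP[_]; apply: not_meets.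
have sRR1 : R \subset reach F D M1 r.
  suff /subset_trans : R \subset R :&: reach F D M1 r by apply; apply: subsetIr.
  apply: reach_min => [|u v /setIP[uR uR1] uv]; first by rewrite inE !mem_reach.
  rewrite inE (reach_closed uR uv) /=; apply: reach_closed uR1 _.
  case/exists_inP: uv => f fF /and3P[uf vf fM]; apply: (passableI fF uf vf).
  case/orP: fM => [fM|->]; last exact: orbT.
  apply/orP; left; apply: contraNN fM => /setIdP[/setUP fM1 _].
  by case: fM1 => [/N_R/(_ uf)|/setDP[/setIdP[]]//]; rewrite uR.
apply/properP; split=> //; exists y.
  have eN : e \notin N by apply: contraTN xR => /N_R; apply.
  apply: reach_closed (subsetP sRR1 x xR) (passableI eF xe ye _).
  by rewrite !inE (negPf eN) (meetsI ye yN) !negb_and /= negbK; case: (e \in M).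
by have /endpointsP[f /N_R] := yN; apply.
Qed.

Hypothesis class1G : hereditarily_class1 G.

Lemma ex_peeling F D : 0 < D -> (forall x, degree F x <= D) ->
  exists M, peeling F D M.
Proof.
move=> D_gt0 degD; have [c cP] := class1G degD.
exists (edges_meeting (color_class F c 0) (full F D)).
apply: peeling_meeting_full.
- by apply/subsetP=> e /setIdP[].
- exact: matching_color_class cP.2.
- exact: full_sub_color_class.
Qed.

Lemma ex_outside_matching F D M R e x y :
    (forall z, degree F z <= D) -> peeling F D M -> passable_closed F D M R ->
    e \in F -> x \in val e -> y \in val e -> x \in R -> y \notin R ->
  exists N, [/\ N \subset outside F R, matching N,
    full (outside F R) D \subset endpoints N & y \in endpoints N].
Proof.
move=> degD MP Rcl eF xe ye xR yR; have [sMF mM _ _] := MP.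
have [eM xD] := passable_closed_boundary Rcl eF xe ye xR yR.
have D_gt1 : 1 < D.
  apply: leq_ltn_trans (_ : degree F x < D).
    by rewrite degree_gt0 (mem_endpoints eF).
  by move: xD; rewrite inE ltn_neqAle degD => ->.
have [f fH yf] : exists2 f, f \in outside F R & y \in val f.
  have := peeling_boundary_full MP Rcl eF xe ye xR yR.
  rewrite inE (degreeD_matching mM) ?(mem_endpoints eM) // => /eqP degy.
  have /endpointsP[f /setDP[fF fM] yf] : y \in endpoints (F :\: M).
    by rewrite -degree_gt0 -ltnS degy.
  exists f; rewrite // mem_outside fF; apply: contraNN fM => /meetsP[z zf zR].
  by have [] := passable_closed_boundary Rcl fF zf yf zR yR.
have [c cP] : exists c, edge_coloring (outside F R) D c.
  by apply: class1G => z; apply: leq_trans (degD z); apply/degreeS/subsetDl.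
exists (color_class (outside F R) c (c f)); split.
- by apply/subsetP=> g /setIdP[].
- exact: matching_color_class cP.2.
- exact: full_sub_color_class cP (cP.1 f fH).
- by apply: mem_endpoints yf; rewrite inE fH eqxx.
Qed.

Lemma peeling_extend F D M r :
    (forall x, degree F x <= D) -> peeling F D M ->
  component F r \subset reach F D M r \/
  exists2 M1, peeling F D M1 & reach F D M r \proper reach F D M1 r.
Proof.
move=> degD MP; have Rcl := @reach_closed F D M r.
set R := reach F D M r in Rcl *.
have [/exists_inP[e eF /andP[/meetsP[x xe xR] /subsetPn[y ye yR]]]|noexit] :=
  boolP [exists e in F, meets R e && ~~ (val e \subset R)]; last first.
  left; apply: component_min (mem_reach _ _ _ _) _ => e eF eR.
  by apply: contraNT noexit => esub; apply/exists_inP; exists e; rewrite // eR.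
right; have [sMF mM _ _] := MP.
have [N [sN mN covN yN]] := ex_outside_matching degD MP Rcl eF xe ye xR yR.
exists (edges_meeting (exchange M N R) (full F D)); last first.
  exact: proper_reach_exchange sN eF xe xR ye yN.
apply: peeling_meeting_full; first 1 last.
- exact: matching_exchange.
- exact: full_sub_exchange.
rewrite subUset (subset_trans sN) ?subsetDl //.
by apply/subsetP=> g /setDP[/setIdP[/(subsetP sMF)]].
Qed.

Lemma ex_reaching_peeling F D r : 0 < D -> (forall x, degree F x <= D) ->
  exists2 M, peeling F D M & component F r \subset reach F D M r.
Proof.
move=> D_gt0 degD; have [M MP] := ex_peeling D_gt0 degD.
have [n] := ubnP (#|G| - #|reach F D M r|); elim: n M MP => // n IHn M MP ltn.
have [|[M1 M1P /proper_card ltR]] := peeling_extend r degD MP.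
  by exists M.
apply: (IHn M1 M1P); rewrite -ltnS; apply: leq_trans ltn.
by rewrite ltnS ltn_sub2l // (leq_trans ltR (max_card _)).
Qed.

End Peelings.

Section RootedGreedy.

Variable G : sgraph.
Implicit Types (F H M T : {set edge G}) (e f : edge G) (r s x y : G).
Implicit Types (c : edge G -> nat) (D k : nat).

Definition touched r T := r |: endpoints T.

(* Colours are numbered from 0 here, one below those of [greedy_coloring]; [T]
   is the set of edges already coloured. *)
Definition growable r c T e := meets (touched r T) e &&
  [forall k : 'I_(c e), exists x in val e, nat_of_ord k \in colors_at T c x].

Definition greedy_closed F r c T :=
  {in F, forall e, growable r c T e -> e \in T}.

(* [growable] is monotone in [T], so the edges of the component of r have an
   ordering in which each edge is growable from the previous ones as soon as no
   proper subset of them is stuck. *)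
Definition rooted_greedy F r c :=
  forall T, greedy_closed F r c T -> edges_meeting F (component F r) \subset T.

Lemma growableP r c T e : reflect
  (meets (touched r T) e /\
   forall k, k < c e -> exists2 x, x \in val e & k \in colors_at T c x)
  (growable r c T e).
Proof.
apply: (iffP andP) => -[te lower]; split=> //.
  by move=> k ltk; apply/exists_inP; apply: (forallP lower (Ordinal ltk)).
by apply/forallP=> k; apply/exists_inP/lower.
Qed.

Lemma growable_mono r r' c T T' e :
    r \in touched r' T' -> T \subset T' -> growable r c T e ->
  growable r' c T' e.
Proof.
move=> rT' sTT' /growableP[te lower]; apply/growableP; split.
  apply: meetsS te; rewrite subUset sub1set rT' /=.
  exact: subset_trans (endpointsS sTT') (subsetUr _ _).
move=> k /lower[x xe kx]; exists x => //; apply: colors_atS kx.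
by apply/subsetP=> f /setIdP[/(subsetP sTT')].
Qed.

Lemma eq_growable r c c' T e :
  {in e |: T, c =1 c'} -> growable r c T e = growable r c' T e.
Proof.
move=> eqc; rewrite /growable (eqc e (setU11 _ _)); congr (_ && _).
apply: eq_forallb => k; apply: eq_existsb => x; congr (_ && _).
congr (_ \in _); apply/eq_in_map => f; rewrite mem_enum => /setIdP[fT _].
by apply: eqc; rewrite inE fT orbT.
Qed.

Lemma eq_rooted_greedy F r c c' :
    {in edges_meeting F (component F r), c =1 c'} ->
  rooted_greedy F r c -> rooted_greedy F r c'.
Proof.
move=> eqc cG T Tcl; set C := edges_meeting _ _ in eqc.
suff /cG/subset_trans : greedy_closed F r c (T :&: C) by apply; apply: subsetIl.
move=> e eF growe; have eC : e \in C.
  have /growableP[/meetsP[x xe xT] _] := growe.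
  rewrite inE eF; apply: meetsI xe _.
  case/setU1P: xT => [->|/endpointsP[f /setIP[_ /setIdP[fF fC]] xf]].
    by rewrite inE connect0.
  have /meetsP[y yf yC] := fC.
  exact: component_edge fF yf xf yC.
rewrite inE eC andbT; apply: Tcl => //; move: growe.
rewrite (@eq_growable _ _ c') => [|f /setU1P[->|/setIP[_]]]; [|exact: eqc..].
by apply: growable_mono; rewrite ?setU11 ?subsetIl.
Qed.

Lemma greedy_closed_mem F r c T e x :
    greedy_closed F r c T -> e \in F -> x \in val e -> x \in touched r T ->
    (forall k, k < c e -> k \in colors_at T c x) ->
  e \in T.
Proof.
move=> Tcl eF xe xT lower; apply: Tcl eF _; apply/growableP; split.
  exact: meetsI xT.
by move=> k /lower; exists x.
Qed.

Lemma touched_component F H r s c T x :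
    greedy_closed F r c T -> H \subset F -> rooted_greedy H s c ->
    s \in touched r T -> x \in component H s ->
  x \in touched r T /\ star H x \subset T.
Proof.
move=> Tcl /subsetP sHF sG sT xs.
have sub : edges_meeting H (component H s) \subset T.
  apply: sG => e /sHF eF growe; apply: Tcl eF _; exact: growable_mono growe.
have starT : star H x \subset T.
  apply/subsetP=> e /setIdP[eH xe]; apply: (subsetP sub).
  by rewrite inE eH (meetsI xe).
split=> //; have [->//|/endpointsP[e eH xe]] := component_endpoint xs.
rewrite inE; apply/orP; right; apply: mem_endpoints (xe).
by apply: (subsetP starT); rewrite inE eH.
Qed.

Lemma ex_componentwise_coloring F D step r entry rank :
    component_entries (linked F) step r entry rank ->
    (forall s, exists c, edge_coloring F D c /\ rooted_greedy F s c) ->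
  exists c, edge_coloring F D c /\ forall x, rooted_greedy F (entry x) c.
Proof.
move=> [x_entry entry_eq _] /fin_all_exists[C CP].
pose c e := C (entry (xchoose (edge_vertex e))) e.
have cE e x : e \in F -> x \in val e -> c e = C (entry x) e.
  move=> eF xe; rewrite /c (@entry_eq _ x) //.
  exact/connect1/(linkedI eF)/xe/(xchooseP (edge_vertex e)).
exists c; split=> [|x].
  split=> [e eF|e f eF fF ef].
    have [x xe] := edge_vertex e; rewrite (cE e x) //.
    by case: (CP (entry x)) => -[cD _] _; apply: cD.
  have /share_endpointP[x xe xf] := ef; rewrite (cE e x) // (cE f x) //.
  by case: (CP (entry x)) => -[_ cP] _; apply: cP.
apply: eq_rooted_greedy (CP (entry x)).2 => e /setIdP[eF /meetsP[y ye]].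
rewrite inE => xy.
by rewrite (cE e y) // -(entry_eq _ _ xy) -(entry_eq _ _ (x_entry x)).
Qed.

Section PeeledColoring.

Variables (F M : {set edge G}) (D : nat) (r : G) (c : edge G -> nat).
Variables (entry : G -> G) (rank : G -> nat) (T : {set edge G}).
Hypothesis MP : peeling F D.+1 M.
Hypothesis cP : edge_coloring F D.+1 c.
Hypothesis cM : {in M, forall e, c e = D}.
Hypothesis entries :
  component_entries (linked (F :\: M)) (passable F D.+1 M) r entry rank.
Hypothesis cG : forall x, rooted_greedy (F :\: M) (entry x) c.
Hypothesis Tcl : greedy_closed F r c T.

Lemma peeled_edge_mem e x :
    e \in M -> x \in val e -> x \in full F D.+1 ->
    x \in touched r T -> star (F :\: M) x \subset T ->
  e \in T.
Proof.
have [sMF _ _ _] := MP; move=> eM xe xD xT /subsetP sT.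
apply: (greedy_closed_mem Tcl (subsetP sMF e eM) xe xT) => k.
rewrite cM // => ltk; have /colors_atP[f [fF xf fk]] : k \in colors_at F c x.
  by apply: colors_at_full cP _ (ltnW ltk); move: xD; rewrite inE => /eqP->.
rewrite -fk mem_colors_at // sT // !inE fF xf !andbT.
by apply: contraTN ltk => /cM <-; rewrite fk ltnn.
Qed.

Lemma touched_from_entry x : entry x \in touched r T ->
  x \in touched r T /\ star (F :\: M) x \subset T.
Proof.
have [x_entry _ _] := entries; move=> xT.
apply: (touched_component Tcl (subsetDl _ _) (@cG x) xT).
by rewrite inE linked_connect_sym.
Qed.

Lemma touched_entry x : x \in reach F D.+1 M r -> entry x \in touched r T.
Proof.
have [x_entry entry_eq entryP] := entries.
have [n] := ubnP (rank (entry x)); elim: n x => // n IHn x ltn.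
rewrite inE => /entryP[->|[y [ry /exists_inP[e eF yxe] lty]]].
  exact: setU11.
have [ye xe eM_yD] := and3P yxe; have eM : e \in M.
  apply: contraTT lty => eM; rewrite -leqNgt (entry_eq y (entry x)).
    by rewrite -(entry_eq _ _ (x_entry x)).
  by apply/connect1/(linkedI _ ye xe); rewrite inE eM.
have [|yT sT] := @touched_from_entry y.
  by apply: IHn; rewrite ?inE //; apply: leq_trans lty ltn.
rewrite inE; apply/orP; right; apply: mem_endpoints xe.
by apply: (peeled_edge_mem eM ye) => //; move: eM_yD; rewrite eM.
Qed.

Lemma component_sub_greedy_closed :
    component F r \subset reach F D.+1 M r ->
  edges_meeting F (component F r) \subset T.
Proof.
move=> /subsetP reachF; have [_ _ _ Mfull] := MP.
have explored x : x \in component F r ->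
    x \in touched r T /\ star (F :\: M) x \subset T.
  by move/reachF/touched_entry/touched_from_entry.
apply/subsetP=> e /setIdP[eF /meetsP[x xe rx]].
have [eM|eM] := boolP (e \in M).
  have /meetsP[y ye yD] := Mfull e eM.
  have [yT sT] := explored y (component_edge eF xe ye rx).
  exact: peeled_edge_mem eM ye yD yT sT.
by have [_ /subsetP] := explored x rx; apply; rewrite !inE eM eF.
Qed.

End PeeledColoring.

Lemma linked_sub_passable F D M : subrel (linked (F :\: M)) (passable F D M).
Proof.
move=> x y /exists_inP[e /setDP[eF eM] /andP[xe ye]].
by apply: passableI eF xe ye _; rewrite eM.
Qed.

Lemma degree_peeling F D M x :
  peeling F D.+1 M -> degree F x <= D.+1 -> degree (F :\: M) x <= D.
Proof.
move=> [sMF mM covM _]; rewrite leq_eqVlt => /predU1P[xD|ltD].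
  by rewrite -ltnS -(degreeD_matching mM sMF) ?xD // (subsetP covM) // inE xD.
exact: leq_trans (degreeS _ (subsetDl _ _)) _.
Qed.

Theorem ex_rooted_greedy F D r :
    hereditarily_class1 G -> (forall x, degree F x <= D) ->
  exists c, edge_coloring F D c /\ rooted_greedy F r c.
Proof.
move=> class1G; elim: D F r => [|D IHD] F r degD.
  have -> : F = set0.
    apply/setP=> e; rewrite inE; apply: contraTF (degD _) => eF.
    rewrite -ltnNge degree_gt0.
    exact: mem_endpoints eF (xchooseP (edge_vertex e)).
  exists (fun=> 0); split=> [|T _]; first by split=> e; rewrite inE.
  by apply/subsetP=> e /setIdP[]; rewrite inE.
have [M MP reachF] := ex_reaching_peeling class1G r (ltn0Sn D) degD.
have [entry [rank entries]] := ex_component_entries r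
  (@linked_connect_sym _ (F :\: M)) (@linked_sub_passable F D.+1 M).
have [|c [cP cG]] := ex_componentwise_coloring entries (D := D).
  by move=> s; apply: IHD => x; apply: degree_peeling MP (degD x).
have [sMF mM _ _] := MP; pose c' e := if e \in M then D else c e.
have cP' : edge_coloring F D.+1 c' := edge_coloring_add_matching mM sMF cP.
exists c'; split=> // T Tcl.
apply: component_sub_greedy_closed MP cP' _ entries _ Tcl reachF => [e eM|x].
  by rewrite /c' eM.
apply: eq_rooted_greedy (cG x) => e /setIdP[/setDP[_ /negPf eM] _].
by rewrite /c' eM.
Qed.

End RootedGreedy.

Lemma connected_seq_rcons (G : sgraph) n (s : n.-tuple (edge G)) e :
    connected_seq s -> (0 < n -> exists2 f, f \in s & share_endpoint e f) ->
  connected_seq [tuple of rcons s e].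
Proof.
move=> cs es; apply/forallP=> i; apply/implyP=> i_gt0.
have widen (j : 'I_n) :
    tnth [tuple of rcons s e] (widen_ord (leqnSn n) j) = tnth s j.
  by rewrite !(tnth_nth e) /= nth_rcons size_tuple ltn_ord.
have [lt_in|le_ni] := ltnP i n.
  have /existsP[j /andP[ltj sh]] := implyP (forallP cs (Ordinal lt_in)) i_gt0.
  apply/existsP; exists (widen_ord (leqnSn n) j); rewrite ltj widen.
  have -> : i = widen_ord (leqnSn n) (Ordinal lt_in) by apply: val_inj.
  by rewrite widen.
have iE : i = n :> nat by apply/eqP; rewrite eqn_leq le_ni andbT -ltnS.
have [|f /tnthP[j ->] sh] := es; first by rewrite -iE.
apply/existsP; exists (widen_ord (leqnSn n) j); rewrite widen /= iE ltn_ord /=.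
by rewrite (tnth_nth e) /= nth_rcons size_tuple iE ltnn eqxx.
Qed.

Section GreedySequences.

Variable G : sgraph.
Implicit Types (s : seq (edge G)) (e f : edge G) (r : G).
Implicit Types (c : edge G -> nat) (l : seq nat) (D k : nat).

Lemma fresh_colorP l : fresh_color l \notin l.
Proof. by rewrite /fresh_color; case: ex_minnP => m /andP[]. Qed.

Lemma fresh_colorE l k :
  k.+1 \notin l -> (forall j, j < k -> j.+1 \in l) -> fresh_color l = k.+1.
Proof.
move=> kl ltl; rewrite /fresh_color; case: ex_minnP => m /andP[m_gt0 ml] min_m.
apply/eqP; rewrite eqn_leq min_m ?kl //=; case: m m_gt0 ml {min_m} => // m _ ml.
by rewrite ltnS leqNgt; apply: contraNN ml; apply: ltl.
Qed.

Lemma greedy_coloring_rcons s e :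
  greedy_coloring (rcons s e) = greedy_step (greedy_coloring s) e.
Proof. exact: foldl_rcons. Qed.

Lemma map_fst_greedy_coloring s : [seq p.1 | p <- greedy_coloring s] = s.
Proof.
elim/last_ind: s => // s e IHs.
by rewrite greedy_coloring_rcons map_rcons IHs.
Qed.

Lemma greedy_coloring_proper s p q :
    uniq s -> p \in greedy_coloring s -> q \in greedy_coloring s ->
  share_endpoint p.1 q.1 -> p.2 = q.2 -> p.1 = q.1.
Proof.
elim/last_ind: s p q => // s e IHs p q; rewrite rcons_uniq => /andP[_ us].
set l := [seq p.2 | p <- greedy_coloring s & share_endpoint e p.1].
have fresh p' :
    p' \in greedy_coloring s -> share_endpoint e p'.1 -> p'.2 != fresh_color l.
  move=> ps ep; apply: contraNneq (fresh_colorP l) => <-.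
  by apply: map_f; rewrite mem_filter ep.
rewrite greedy_coloring_rcons !mem_rcons !inE.
move=> /predU1P[->|ps] /predU1P[->|qs] //=.
- by move=> eq /esym/eqP; rewrite (negPf (fresh _ qs eq)).
- by rewrite share_endpointC => ep /eqP; rewrite (negPf (fresh _ ps ep)).
- exact: IHs.
Qed.

Lemma chromatic_index_le_greedy s :
  edge_ordering s -> chromatic_index G <= greedy_num_colors s.
Proof.
move=> sE; rewrite /chromatic_index; case: ex_minnP => m _; apply.
have us : uniq s by rewrite (perm_uniq sE) enum_uniq.
pose cols := undup [seq p.2 | p <- greedy_coloring s].
have /fin_all_exists[col colP] :
    forall e, exists k, (e, k) \in greedy_coloring s.
  move=> e; have : e \in [seq p.1 | p <- greedy_coloring s].
    by rewrite map_fst_greedy_coloring (perm_mem sE) mem_enum.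
  by case/mapP=> -[f k] fk /= ->; exists k.
have col_mem e : col e \in cols.
  by rewrite mem_undup; apply: (map_f snd (colP e)).
have ltc e : index (col e) cols < size cols by rewrite index_mem.
apply/existsP; exists [ffun e => Ordinal (ltc e)].
apply/forallP=> e; apply/forallP=> f.
apply/implyP=> /andP[nef ef]; rewrite !ffunE; apply: contraNneq nef => -[].
move/(congr1 (nth 0 cols)); rewrite !nth_index // => colE; apply/eqP.
exact: (greedy_coloring_proper us (colP e) (colP f) ef).
Qed.

Lemma degree_le_chromatic_index x : degree [set: edge G] x <= chromatic_index G.
Proof.
rewrite /chromatic_index; case: ex_minnP => m /existsP[c /forallP cP] _.
rewrite /degree -[leqRHS]card_ord -(@card_in_imset _ _ c).
  exact: max_card.
move=> e f /[!inE]/= xe xf cef; apply/eqP; apply: contraTT (eqxx (c e)) => nef.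
rewrite {2}cef; apply: (implyP (forallP (cP e) f)); rewrite nef.
exact: share_endpointI xe xf.
Qed.

Definition greedy_realizes s c :=
  greedy_coloring s = [seq (e, (c e).+1) | e <- s].

Lemma greedy_realizes_rcons s c r e :
    proper_on setT c -> e \notin s -> growable r c [set f in s] e ->
  greedy_realizes s c -> greedy_realizes (rcons s e) c.
Proof.
move=> cP es /growableP[_ lower] sc.
rewrite /greedy_realizes greedy_coloring_rcons map_rcons -sc.
congr (rcons _ (_, _)).
have memP k : reflect (exists f, [/\ f \in s, share_endpoint e f & c f = k])
    (k.+1 \in [seq p.2 | p <- greedy_coloring s & share_endpoint e p.1]).
  rewrite sc filter_map -map_comp.
  apply: (iffP mapP) => [[f]|[f [fs ef <-]]].
    by rewrite mem_filter => /andP[ef fs] [->]; exists f.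
  by exists f; rewrite // mem_filter /= ef.
apply: fresh_colorE => [|k /lower[x xe /colors_atP[f [/[!inE] fs xf fk]]]].
  apply/memP=> -[f [fs ef cef]]; case/negP: es.
  by rewrite (cP e f) ?inE ?cef.
by apply/memP; exists f; split=> //; apply: share_endpointI xf.
Qed.

Lemma greedy_num_colors_le s c D :
  (forall e, c e < D) -> greedy_realizes s c -> greedy_num_colors s <= D.
Proof.
move=> cD sc; rewrite /greedy_num_colors sc -map_comp -(size_iota 1 D).
apply: uniq_leq_size (undup_uniq _) _ => k.
rewrite mem_undup => /mapP[e _ ->].
by rewrite mem_iota /= add1n ltnS cD.
Qed.

End GreedySequences.

Section ConnectedGreedy.

Variables (G : sgraph) (connG : connected_graph G).
Implicit Types (T : {set edge G}) (e : edge G) (r : G).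
Implicit Types (c : edge G -> nat) (D : nat).


Lemma component_setT r : component setT r = setT.
Proof.
apply/setP=> x; rewrite !inE; apply: connect_sub (connG r x) => y z.
by move=> /linked_adj/connect1.
Qed.

Lemma ex_growable_notin r c T e : rooted_greedy setT r c -> e \notin T ->
  exists2 f, f \notin T & growable r c T f.
Proof.
move=> cG eT; apply/exists_inP; apply: contraNT eT => /exists_inPn stuck.
have [x xe] := edge_vertex e; apply: (subsetP (cG T _)).
  by move=> f _; apply: contraLR => /stuck.
by rewrite inE component_setT inE (meetsI xe) ?inE.
Qed.

Lemma ex_greedy_tuple r c n :
    proper_on setT c -> rooted_greedy setT r c -> n <= #|edge G| ->
  exists s : n.-tuple (edge G), [/\ uniq s, connected_seq s, greedy_realizes s c
    & 0 < n -> r \in endpoints [set e in s]].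
Proof.
move=> cP cG; elim: n => [_|n IHn ltn].
  by exists [tuple]; split=> //; apply/forallP=> -[].
have [s [us cs sc rs]] := IHn (ltnW ltn).
have [|e0 e0s] := ex_notin_seq (s := s); first by rewrite size_tuple.
have e0T : e0 \notin [set f in s] by rewrite inE.
have [e /[!inE] es growe] := ex_growable_notin cG e0T.
have /growableP[/meetsP[x xe xs] _] := growe.
exists [tuple of rcons s e]; split.
- by rewrite rcons_uniq es.
- apply: connected_seq_rcons => // /rs r_s; have : x \in endpoints [set f in s].
    by case/setU1P: xs => [->|].
  case/endpointsP=> f /[!inE] fs xf; exists f => //.
  exact: share_endpointI xf.
- exact: greedy_realizes_rcons growe sc.
have sub : [set f in s] \subset [set f in rcons s e].
  by apply/subsetP=> f /[!inE] fs; rewrite mem_rcons inE fs orbT.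
move=> _; have [n0|/rs] := posnP n; last exact/subsetP/endpointsS.
apply: (mem_endpoints (e := e)); first by rewrite inE mem_rcons mem_head.
case/setU1P: xs => [<-//|/endpointsP[f /[!inE]]].
by rewrite memtE (size0nil (etrans (size_tuple s) n0)).
Qed.

Lemma connected_greedy_chromatic_index_le (s : #|edge G|.-tuple (edge G)) :
    uniq s -> connected_seq s ->
  connected_greedy_chromatic_index connG <= greedy_num_colors s.
Proof.
move=> us cs; rewrite /connected_greedy_chromatic_index.
case: ex_minnP => k _; apply; apply/existsP; exists s.
by rewrite cs eqxx /edge_ordering perm_eq_enum ?size_tuple.
Qed.

Lemma chromatic_index_le_connected_greedy :
  chromatic_index G <= connected_greedy_chromatic_index connG.
Proof.
rewrite /connected_greedy_chromatic_index.
case: ex_minnP => k /existsP[s /and3P[sE _ /eqP<-]] _.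
exact: chromatic_index_le_greedy.
Qed.

Lemma connected_greedy_chromatic_index_le_degree D :
    hereditarily_class1 G -> (forall x, degree [set: edge G] x <= D) ->
  connected_greedy_chromatic_index connG <= D.
Proof.
move=> class1G degD; have [E0|/card_gt0P[e0 _]] := posnP #|edge G|.
  have [s /andP[us cs]] := ex_connected_seq connG (leqnn #|edge G|).
  apply: leq_trans (connected_greedy_chromatic_index_le us cs) _.
  by rewrite /greedy_num_colors (size0nil (etrans (size_tuple s) E0)).
have [r _] := edge_vertex e0.
have [c [[cD cP] cG]] := ex_rooted_greedy r class1G degD.
have [s [us cs sc _]] := ex_greedy_tuple cP cG (leqnn _).
apply: leq_trans (connected_greedy_chromatic_index_le us cs) _.
by apply: greedy_num_colors_le sc => e; apply: cD; rewrite inE.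
Qed.

End ConnectedGreedy.

Theorem theorem2 (G : sgraph) (connG : connected_graph G) (bipG : bipartite G) :
  connected_greedy_chromatic_index connG = chromatic_index G.
Proof.
have [A bipA] := bipG; apply/eqP; rewrite eqn_leq.
rewrite chromatic_index_le_connected_greedy andbT.
apply: connected_greedy_chromatic_index_le_degree (konig bipA) _.
exact: degree_le_chromatic_index.
Qed.
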